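(* Let $G$ be a nilpotent group and let $H$ be a subgroup of $G$ which is a CAut-basis of $G$. Then $Z_n(H)=Z_n(G)\cap H$ for every integer $n\ge 0$. In particular, $H$ and $G$ have the same nilpotency class.
   Context: For a group $G$, $\mathrm{CAut}\,G$ denotes the group of all automorphisms of $G$ acting trivially on both $Z(G)$ and $G/Z(G)$, where $Z(G)$ is the centre of $G$. A subset $X$ of $G$ is a CAut-basis of $G$ if any two elements of $\mathrm{CAut}\,G$ having the same restriction to $X$ are equal. $Z_n(G)$ denotes the $n$-th term of the upper central series of $G$, with $Z_0(G)=1$.
   Formalization: The claim on equal nilpotency class is proved except when G is a nontrivial abelian group and H = 1; there it is false, since CAut G is trivial, so H = 1 is a CAut-basis of class 0 while G has class 1. *)

(* Defs.v *)
From mathcomp Require Import all_boot.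
From mathcomp Require Import boolp classical_sets.

Set Implicit Arguments.
Unset Strict Implicit.
Unset Printing Implicit Defensive.

Local Open Scope classical_set_scope.
Local Open Scope group_scope.

(* Classically every type is a choiceType, so [groupType] covers arbitrary,
   possibly infinite, groups.  A subgroup [K] of [G] is a set of elements of
   [G], with [G] itself rendered as [setT]. *)

Definition is_subgroup (G : groupType) (K : set G) : Prop :=
  group_closed (mem K).

Definition center (G : groupType) (K : set G) : set G :=
  [set x | K x /\ forall y, K y -> commute x y].

(* Z_(n+1)(K) / Z_n(K) is the centre of K / Z_n(K): the cosets of x and y
   commute modulo Z_n(K) exactly when [~ x, y] lies in Z_n(K). *)
Fixpoint upper_central (G : groupType) (K : set G) (n : nat) : set G :=
  if n is m.+1 then
    [set x | K x /\ forall y, K y -> upper_central K m [~ x, y]]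
  else [set 1].

Definition nilpotent (G : groupType) (K : set G) : Prop :=
  exists n, upper_central K n = K.

Definition has_nilpotency_class (G : groupType) (K : set G) (c : nat) : Prop :=
  upper_central K c = K /\ forall n, upper_central K n = K -> (c <= n)%N.

Definition automorphism (G : groupType) (f : G -> G) : Prop :=
  bijective f /\ monoid_morphism f.

(* [x^-1 * f x] in Z(G) says that [x] and [f x] have the same coset of Z(G). *)
Definition CAut (G : groupType) : set (G -> G) :=
  [set f | [/\ automorphism f,
               forall z, center [set: G] z -> f z = z
             & forall x, center [set: G] (x^-1 * f x)]].

Definition CAut_basis (G : groupType) (X : set G) : Prop :=
  forall f g, CAut f -> CAut g -> {in X, f =1 g} -> f =1 g.

(* Main.v *)
Require Import Defs.
From mathcomp Require Import all_boot.
From mathcomp Require Import boolp classical_sets.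

(** Central automorphisms [f] fixing the centre pointwise are the maps
    [x |-> x * phi x] with [phi : G -> Z(G)] a homomorphism that kills [Z(G)].
    Hence a subset [H] that is a CAut-basis enjoys a vanishing property: a
    homomorphism from [G] to [Z(G)] that kills [Z(G)] and [H] is trivial
    ([CAut_basis_hom_trivial]).

    Only homomorphisms into [Z(G)] are controlled this way, but each factor
    [Z_(k+1) / Z_k] embeds, through [a |-> ([~ a, h])_h], into a product of
    copies of [Z_k / Z_(k-1)].  Going down this ladder gives the same vanishing
    for homomorphisms into [Z_(k+1) / Z_k] ([CAut_basis_hom_mod_trivial]).

    If [x] lies in [Z_(k+2)], then [g |-> [~ x, g]] is such a homomorphism into
    [Z_(k+1) / Z_k]; so if [x] commutes with [H] modulo [Z_k], it commutes with
    [G] modulo [Z_k].  In a nilpotent group [x] lies in some term of the series,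
    and descending from there shows that an [x] with [[~ x, H]] inside [Z_n]
    always lies in [Z_(n+1)] ([commg_upper_central]).  This is the inductive
    step of [Z_n(H) = Z_n(G) `&` H].

    For the classes, suppose [H] is contained in [Z_(n+1)].  Then every [x] in
    [G] satisfies [[~ x, H]] inside [Z_n], so [Z_(n+1) = G].  The argument
    breaks down only for [H] trivial, where it gives no more than [G] abelian:
    a group such as the one of order 2 has no nontrivial homomorphism that
    kills its centre, so its trivial subgroup is a CAut-basis, although the
    classes are 0 and 1.  This is the case that the hypothesis of the second
    assertion excludes. *)

Local Open Scope classical_set_scope.
Local Open Scope group_scope.

Local Notation Z := (upper_central [set: _]).

(** * The upper central series of a group *)

Lemma commgM (G : groupType) (x g h : G) :
  [~ x, g * h] = [~ x, h] * [~ x, g] ^ h.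
Proof. by rewrite !commgEl conjMg conjgM conjVg -mulgA mulVKg. Qed.

Lemma conjg_mulR (G : groupType) (x y : G) : x ^ y = x * [~ x, y].
Proof. by rewrite commgEl mulVKg. Qed.

Lemma commMg (G : groupType) (x y g : G) :
  [~ x * y, g] = [~ x, g] * [~ [~ x, g], y] * [~ y, g].
Proof.
rewrite -conjg_mulR !commgEl conjMg [LHS]mulgA [RHS]mulgA; congr (_ * _).
by rewrite invgM [(_ * x ^ g) ^ y]conjgE -!mulgA mulgV mulg1.
Qed.

Lemma upper_centralS (G : groupType) n (x : G) :
  Z n.+1 x <-> forall y, Z n [~ x, y].
Proof. by split=> [[_ xZ] y | xZ]; [exact: xZ | split]. Qed.

Lemma center_upper_central1 (G : groupType) (x : G) :
  center [set: G] x <-> Z 1%N x.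
Proof.
rewrite upper_centralS; split=> [[_ cx] y | cx]; first exact/eqP/commgP/cx.
by split=> // y _; apply/commgP/eqP/cx.
Qed.

Lemma upper_central1 (G : groupType) n : Z n (1 : G).
Proof. by elim: n => //= n IH; split=> // y _; rewrite comm1g. Qed.

Lemma upper_centralJ (G : groupType) n (x h : G) : Z n x -> Z n (x ^ h).
Proof.
elim: n x h => [|n IH] x h; first by move=> /= ->; rewrite conj1g.
rewrite !upper_centralS => xZ g.
by rewrite -(conjgKV h g) -conjRg; apply: IH; apply: xZ.
Qed.

Lemma upper_centralM (G : groupType) n (x y : G) :
  Z n x -> Z n y -> Z n (x * y).
Proof.
elim: n x y => [|n IH] x y; first by move=> /= -> ->; rewrite mulg1.
rewrite !upper_centralS => xZ yZ g.
rewrite commMg -conjg_mulR; apply: IH (yZ g).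
exact/upper_centralJ/xZ.
Qed.

Lemma upper_centralV (G : groupType) n (x : G) : Z n x -> Z n x^-1.
Proof.
elim: n x => [|n IH] x; first by move=> /= ->; rewrite invg1.
rewrite !upper_centralS => xZ g.
have -> : [~ x^-1, g] = [~ x, g]^-1 ^ x^-1.
  by rewrite !commgEl (conjVg x) [RHS]conjgE invgK (invgM x^-1) invgK mulgK.
exact/upper_centralJ/IH/xZ.
Qed.

Lemma upper_centralR (G : groupType) n (x y : G) : Z n x -> Z n [~ x, y].
Proof.
by move=> xZ; rewrite commgEl; apply: upper_centralM;
  [exact: upper_centralV | exact: upper_centralJ].
Qed.

Lemma upper_central_le (G : groupType) m n (x : G) :
  (m <= n)%N -> Z m x -> Z n x.
Proof.
move=> /subnK <- xZ; elim: (n - m)%N => //= k IH.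
by apply/upper_centralS => y; apply: upper_centralR.
Qed.

(** * Homomorphisms that vanish on a CAut-basis *)

Lemma CAut_of_hom (G : groupType) (phi : G -> G) :
  (forall g, center [set: G] (phi g)) -> {morph phi : g h / g * h} ->
  (forall z, center [set: G] z -> phi z = 1) ->
  CAut (fun x => x * phi x).
Proof.
move=> phiZ phiM phi0.
have phi1 : phi 1 = 1 by apply: (mulgI (phi 1)); rewrite -phiM !mulg1.
have phi_phi g : phi (phi g) = 1 by apply: phi0.
have phiVphi g : phi (phi g)^-1 = 1.
  by apply: (mulgI (phi (phi g))); rewrite -phiM mulgV phi1 phi_phi mulg1.
split.
- split; last first.
    split=> [|x y]; first by rewrite phi1 mulg1.
    have [_ /(_ y I) cxy] := phiZ x.
    by rewrite phiM !mulgA -(mulgA x y) -cxy mulgA.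
  (* The inverse is [x |-> x / phi x], because [phi] kills its own values. *)
  exists (fun x => x * (phi x)^-1) => x.
    by rewrite phiM phi_phi mulg1 mulgK.
  by rewrite phiM phiVphi mulg1 mulgVK.
- by move=> z /phi0 ->; rewrite mulg1.
- by move=> x; rewrite mulKg.
Qed.

Lemma CAut_basis_hom_trivial (G : groupType) (H : set G) (phi : G -> G) :
  CAut_basis H ->
  (forall g, center [set: G] (phi g)) -> {morph phi : g h / g * h} ->
  (forall z, center [set: G] z -> phi z = 1) -> (forall y, H y -> phi y = 1) ->
  forall g, phi g = 1.
Proof.
move=> basisH phiZ phiM phi0 phiH g.
have one_hom : {morph (fun=> 1 : G) : x y / x * y}.
  by move=> x y /=; rewrite mulg1.
have one_center (x : G) : center [set: G] 1.
  by apply/center_upper_central1/upper_central1.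
apply: (mulgI g); apply: (basisH (fun x => x * phi x) (fun x => x * 1)).
- exact: CAut_of_hom.
- exact: CAut_of_hom.
- by move=> y; rewrite in_setE => /phiH ->.
Qed.

(** Induction on [k]: for fixed [h], [g |-> [~ phi g, h]] is a homomorphism
    modulo [Z_(k-1)] into [Z_k], with the same vanishing.  If it takes its values
    in [Z_(k-1)] for every [h], then [phi g] lies in [Z_k].  The error term [z]
    stands for the congruence modulo [Z_k], and avoids forming quotients. *)
Lemma CAut_basis_hom_mod_trivial (G : groupType) (H : set G) k (phi : G -> G) :
  CAut_basis H ->
  (forall g, Z k.+1 (phi g)) ->
  (forall g h, exists2 z, Z k z & phi (g * h) = phi g * phi h * z) ->
  (forall z, center [set: G] z -> Z k (phi z)) ->
  (forall y, H y -> Z k (phi y)) ->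
  forall g, Z k (phi g).
Proof.
move=> basisH; elim: k phi => [|k IH] phi phiZ phiM phi0 phiH g.
  apply: (CAut_basis_hom_trivial _ H) => // [x|x y].
    exact/center_upper_central1/phiZ.
  by have [_ -> ->] := phiM x y; rewrite mulg1.
have phiR x h : Z k.+1 [~ phi x, h] by move/upper_centralS: (phiZ x).
apply/upper_centralS => h; apply: (IH (fun x => [~ phi x, h])) => //.
- move=> x y; have [z zZ ->] := phiM x y.
  (* Expand by [commMg]; every double commutator lies in [Z_k], and the one in
     the middle is moved to the right by conjugation. *)
  pose a := [~ phi x, h]; pose b := [~ phi y, h].
  exists ([~ a, phi y] ^ b * ([~ [~ phi x * phi y, h], z] * [~ z, h])).
    move/upper_centralS: (phiR x h) => aZ.
    have /upper_centralS xyZ : Z k.+1 [~ phi x * phi y, h].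
      by move: h {a b aZ}; apply/upper_centralS/upper_centralM.
    move/upper_centralS: zZ => zZ.
    apply: upper_centralM; first exact/upper_centralJ/aZ.
    by apply: upper_centralM; [exact: xyZ | exact: zZ].
  rewrite commMg; move: [~ [~ phi x * phi y, h], z] [~ z, h] => c e.
  rewrite commMg -/a -/b -[a * _ * b]mulgA (conjgC [~ a, phi y]).
  by move: ([~ a, phi y] ^ b) => d; move: a b => a b; rewrite !mulgA.
- by move=> z /phi0 /upper_centralS.
- by move=> y /phiH /upper_centralS.
Qed.

(** * Commuting with a CAut-basis modulo the upper central series *)

(** [g |-> [~ x, g]] takes its values in [Z_(k+1)], so by [commgM] it is a
    homomorphism modulo [Z_k], and it kills the centre. *)
Lemma commg_upper_central_step (G : groupType) (H : set G) k (x : G) :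
  CAut_basis H -> Z k.+2 x -> (forall y, H y -> Z k [~ x, y]) -> Z k.+1 x.
Proof.
move=> basisH /upper_centralS xZ xH; apply/upper_centralS.
apply: (CAut_basis_hom_mod_trivial _ H) => // [g h|z [_ cz]].
  exists ([~ [~ x, h], [~ x, g]] * [~ [~ x, g], h]).
    have /upper_centralS xgZ := xZ g; have /upper_centralS xhZ := xZ h.
    by apply: upper_centralM; [exact: xhZ | exact: xgZ].
  by rewrite commgM conjg_mulR [LHS]mulgA [_ * [~ x, g]]commgC -mulgA.
have /commgP/eqP -> : commute x z by apply/commute_sym/cz.
exact: upper_central1.
Qed.

(** Nilpotency places [x] in some [Z_(n+1+d)]; descend on [d]. *)
Lemma commg_upper_central (G : groupType) (H : set G) n (x : G) :
  nilpotent [set: G] -> CAut_basis H ->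
  (forall y, H y -> Z n [~ x, y]) -> Z n.+1 x.
Proof.
move=> [m Zm] basisH xH.
have: Z (n.+1 + m)%N x by apply: (upper_central_le _ m); rewrite ?leq_addl ?Zm.
elim: {Zm} m => [|d IH]; rewrite ?addn0 // addnS addSn => xZ.
apply: IH; apply: (commg_upper_central_step _ H) => // y /xH.
exact/upper_central_le/leq_addr.
Qed.

(** * Upper central series and class of a CAut-basis *)

Lemma upper_central_CAut_basis (G : groupType) (H : set G) :
  nilpotent [set: G] -> is_subgroup H -> CAut_basis H ->
  forall n, upper_central H n = Z n `&` H.
Proof.
move=> nilG [H1 HB] basisH.
have HR x y : H x -> H y -> H [~ x, y].
  have HV z : z \in H -> z^-1 \in H by apply: (group_closedV (conj H1 HB)).
  have HM : mulg_closed (mem H) by apply: (group_closedM (conj H1 HB)).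
  move=> /mem_set Hx /mem_set Hy; apply: set_mem; rewrite commgEl conjgE.
  by apply: (HM); [|apply: (HM); [|apply: (HM)]] => //; apply: HV.
elim=> [|n IH]; apply/seteqP; split=> x.
- by move=> /= ->; split=> //; exact: set_mem H1.
- by case.
- case=> Hx xH; split=> //; apply: (commg_upper_central _ H) => // y Hy.
  have : upper_central H n [~ x, y] by apply: xH.
  by rewrite IH => -[].
- case=> /upper_centralS xZ Hx; split=> // y Hy.
  change (upper_central H n [~ x, y]).
  by rewrite IH; split; [exact: xZ | exact: HR].
Qed.

(** For [n > 0], [[~ y, x]] lies in [Z_(n-1)] for [y] in [H] contained in [Z_n],
    which is what [commg_upper_central] asks of [x].  For [n = 0], [H] is
    trivial, [G] is only known to be abelian, and the hypothesis on trivial [H]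
    concludes. *)
Lemma upper_central_CAut_basis_top (G : groupType) (H : set G) n :
  nilpotent [set: G] -> is_subgroup H -> CAut_basis H ->
  (center [set: G] = [set: G] -> H = [set 1] -> [set: G] = [set 1]) ->
  upper_central H n = H <-> Z n = [set: G].
Proof.
move=> nilG sH basisH triv; rewrite upper_central_CAut_basis //.
split=> [ZH|->]; last by rewrite setTI.
have {}ZH y : H y -> Z n y by rewrite -{1}ZH => -[].
case: n ZH => [|n] ZH.
  apply/esym/triv; apply/seteqP; split=> //.
    move=> x _; apply/center_upper_central1; apply: (commg_upper_central _ H) => //.
    by move=> y /ZH ->; rewrite commg1.
  by move=> y ->; case: sH => /set_mem.
apply/seteqP; split=> // x _; apply: (commg_upper_central _ H) => // y /ZH.
by rewrite -invgR => /upper_centralS yZ; apply/upper_centralV/yZ.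
Qed.

Theorem theorem1p9 (G : groupType) (H : set G) :
  nilpotent [set: G] -> is_subgroup H -> CAut_basis H ->
  (forall n : nat, upper_central H n = upper_central [set: G] n `&` H) /\
  ((center [set: G] = [set: G] -> H = [set 1] -> [set: G] = [set 1]) ->
   exists c : nat,
     has_nilpotency_class H c /\ has_nilpotency_class [set: G] c).
Proof.
move=> nilG sH basisH; split; first exact: upper_central_CAut_basis.
move=> triv.
have topE n : upper_central H n = H <-> Z n = [set: G].
  exact: upper_central_CAut_basis_top.
have exZ : exists n, `[< Z n = [set: G] >].
  by case: nilG => n Zn; exists n; apply/asboolP.
case: (ex_minnP exZ) => c /asboolP Zc c_min.
exists c; split; split=> //; first exact/topE.
- by move=> n /topE Zn; apply/c_min/asboolP.
- by move=> n Zn; apply/c_min/asboolP.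
Qed.
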